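(* Let $\Gamma=\langle\alpha,\beta\rangle$ be a numerical semigroup, where $\alpha<\beta$ are coprime positive integers. Let $n\ge 1$ and let $I=\{0,i_1,\ldots,i_n\}$ be a $\Gamma$-lean set with gaps $i_k=\alpha\beta-a_k\alpha-b_k\beta$ (where $a_k,b_k\in\mathbb{N}_{>0}$, $k=1,\ldots,n$) ordered increasingly with respect to $<_L$, that is, $i_1<_L i_2<_L\cdots<_L i_n$. Let $\Delta_I=\bigcup_{i\in I}(\Gamma+i)$. Then \[ \Delta_I^*=(\Gamma+a_1\alpha)\cup\bigcup_{k=1}^{n-1}(\Gamma+a_{k+1}\alpha+b_k\beta)\cup(\Gamma+b_n\beta). \]
   Context: Here $\mathbb{N}=\{0,1,2,\ldots\}$. A numerical semigroup $\Gamma$ is a submonoid of $(\mathbb{N},+)$ with $\mathbb{N}\setminus\Gamma$ finite; the elements of $L=\mathbb{N}\setminus\Gamma$ are called gaps. $\langle\alpha,\beta\rangle=\{r\alpha+s\beta : r,s\in\mathbb{N}\}$. A $\Gamma$-semimodule is a non-empty subset $\Delta\subseteq\mathbb{Z}$ that is bounded below and satisfies $\Delta+\Gamma\subseteq\Delta$. A $\Gamma$-lean set is a finite subset of $\mathbb{N}$ containing $0$ whose nonzero elements are gaps of $\Gamma$ and such that the positive difference of any two distinct nonzero elements is again a gap of $\Gamma$. For $\Gamma=\langle\alpha,\beta\rangle$, an integer $\ell$ is not in $\Gamma$ if and only if $\ell=\alpha\beta-a\alpha-b\beta$ for some $a,b\in\mathbb{N}_{>0}$; for a gap the pair $(a,b)$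 is unique. For gaps $i=\alpha\beta-a\alpha-b\beta$ and $i'=\alpha\beta-a'\alpha-b'\beta$ one sets $i<_L i'$ if and only if $a>a'$ and $b<b'$; any two distinct nonzero elements of a $\Gamma$-lean set are comparable for $<_L$. The dual of a $\Gamma$-semimodule $\Delta$ is $\Delta^*=\{c\in\mathbb{Z} : c+\Delta\subseteq\Gamma\}$. *)

(* Defs.v *)
From mathcomp Require Import all_boot all_order all_algebra.
From mathcomp Require Import boolp classical_sets functions cardinality.

Set Implicit Arguments.
Unset Strict Implicit.
Unset Printing Implicit Defensive.

Import Order.TTheory GRing.Theory Num.Theory.

Local Open Scope classical_set_scope.

Record numerical_semigroup (Gamma : set nat) : Prop := NumericalSemigroup {
  numsg0 : Gamma 0;
  numsgD : forall x y, Gamma x -> Gamma y -> Gamma (x + y);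
  numsg_cofinite : finite_set (~` Gamma) }.

Definition gap (Gamma : set nat) (l : nat) : Prop := ~ Gamma l.

Definition gen2 (alpha beta : nat) : set nat :=
  [set x | exists r s : nat, x = r * alpha + s * beta].

Record lean_set (Gamma I : set nat) : Prop := LeanSet {
  lean_finite : finite_set I;
  lean0 : I 0;
  lean_gap : forall x, I x -> x <> 0 -> gap Gamma x;
  lean_diff : forall x y, I x -> I y -> x <> 0 -> y <> 0 ->
    x < y -> gap Gamma (y - x) }.

Definition gap_coord (alpha beta l a b : nat) : Prop :=
  [/\ 0 < a, 0 < b &
      (l%:Z = (alpha * beta)%N%:Z - (a * alpha)%N%:Z - (b * beta)%N%:Z)%R].

(* The coordinates of a gap are unique when alpha and beta are coprime, so the
   existential quantification below does not depend on a choice. *)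
Definition ltL (alpha beta i i' : nat) : Prop :=
  exists a b a' b' : nat,
    [/\ gap_coord alpha beta i a b, gap_coord alpha beta i' a' b',
        a' < a & b < b'].

Definition translate (Gamma : set nat) (z : int) : set int :=
  [set (g%:Z + z)%R | g in Gamma].

Arguments translate Gamma%_classical_set_scope z%_ring_scope.

Definition Delta (Gamma I : set nat) : set int :=
  \bigcup_(i in I) translate Gamma i%:Z.

Definition dual (Gamma : set nat) (D : set int) : set int :=
  [set c | [set (c + d)%R | d in D] `<=` [set (g%:Z)%R | g in Gamma]].

(* Main.v *)
Require Import Defs.
From mathcomp Require Import all_boot all_order all_algebra.
From mathcomp Require Import boolp classical_sets functions cardinality.
From mathcomp Require Import zify.

Local Open Scope classical_set_scope.

(** The theorem reads off a staircase in the first quadrant. Represent the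
elements of the semigroup by lattice points, (x, y) standing for
x * alpha + y * beta. Adding the gap with coordinates (a, b) to such an element
gives an element of the semigroup exactly when (x, y) avoids the rectangle
x < a, y < b ([gen2D_gap]): modulo beta the coefficient of alpha is determined,
and inside the rectangle its least possible value forces a negative coefficient
of beta. Since 0 belongs to the lean set, an element of the dual lies in the
semigroup, so the dual consists of the points outside all the rectangles
attached to the (a k, b k) ([dual_DeltaE]).

Along the order of the gaps the a k decrease and the b k increase, so the union
of these rectangles is a staircase, and its complement in the quadrant is the
union of the translated quadrants based at the inner corners (a 1, 0),
(a k.+1, b k) and (0, b n) ([staircaseP]). Translated quadrants correspond to
translates of the semigroup ([translate_gen2E]), which gives the formula. *)

(** * Lattice points and coordinates of gaps *)

Section Gen2.
Set Implicit Arguments.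
Unset Strict Implicit.
Variables (alpha beta : nat).

Lemma gap_coordE l a b : gap_coord alpha beta l a b <->
  [/\ 0 < a, 0 < b & l + a * alpha + b * beta = alpha * beta].
Proof. by split=> -[a0 b0 E]; split=> //; lia. Qed.

Lemma translate_gen2E p q :
  translate (gen2 alpha beta) (p * alpha + q * beta)%N%:Z =
  [set c | exists x y : nat,
     [/\ p <= x, q <= y & c = ((x * alpha + y * beta)%N%:Z)%R]].
Proof.
apply/seteqP; split=> c.
- case=> g [r [s ->]] <-; exists (r + p), (s + q); split; lia.
- case=> x [y [px qy ->]]; exists ((x - p) * alpha + (y - q) * beta).
    by exists (x - p), (y - q).
  by nia.
Qed.

Hypotheses (alpha_gt0 : 0 < alpha) (co_alpha_beta : coprime alpha beta).

Lemma gap_coord_lt l a b : gap_coord alpha beta l a b ->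
  a < beta /\ b <= alpha.
Proof. by move=> /gap_coordE [a0 b0 E]; split; nia. Qed.

(** Coprimality makes a - a' a multiple of beta; this is the only way in which
it enters the proof. *)
Lemma coef_gap_ge a b a' b' :
  a * alpha + b * beta = a' * alpha + b' * beta -> a' < a -> beta <= a - a'.
Proof.
move=> E lt_a.
have Em : (a - a') * alpha = (b' - b) * beta by nia.
have: beta %| (a - a') * alpha by rewrite Em dvdn_mull.
rewrite Gauss_dvdl 1?coprime_sym // => /dvdn_leq; apply.
by rewrite subn_gt0.
Qed.

Lemma gap_coord_inj l a b a' b' : gap_coord alpha beta l a b ->
  gap_coord alpha beta l a' b' -> a = a' /\ b = b'.
Proof.
move=> C C'; have [lt_a _] := gap_coord_lt C.
have [lt_a' _] := gap_coord_lt C'.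
move/gap_coordE: C => [a0 b0 E]; move/gap_coordE: C' => [a0' b0' E'].
have eq_ab : a * alpha + b * beta = a' * alpha + b' * beta by lia.
have eq_a : a = a'.
  case: (ltngtP a a') => // [lt|lt].
  - by have := coef_gap_ge (esym eq_ab) lt; lia.
  - by have := coef_gap_ge eq_ab lt; lia.
by split=> //; move: eq_ab; rewrite eq_a; nia.
Qed.

Lemma gap_coord_ltL i a b i' a' b' : gap_coord alpha beta i a b ->
  gap_coord alpha beta i' a' b' -> ltL alpha beta i i' -> a' < a /\ b < b'.
Proof.
move=> C C' [a1 [b1 [a2 [b2 [C1 C2 lta ltb]]]]].
have [-> ->] := gap_coord_inj C C1.
by have [-> ->] := gap_coord_inj C' C2.
Qed.

(** The gap is both (beta - a) * alpha - b * beta and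
(alpha - b) * beta - a * alpha, so b <= y or a <= x lets one absorb the
negative term. The representation (x, y) is arbitrary, so no normal form has
to be chosen. *)
Lemma gen2D_gap l a b x y : gap_coord alpha beta l a b ->
  gen2 alpha beta (x * alpha + y * beta + l) <-> a <= x \/ b <= y.
Proof.
move=> C; have [lt_a le_b] := gap_coord_lt C.
move/gap_coordE: C => [a0 b0 E]; split=> [[r [s Ers]]|[ax|by_]].
- apply: contrapT => /not_orP [/negP ax /negP by_].
  have Exy : (x + beta) * alpha + y * beta = (r + a) * alpha + (s + b) * beta.
    by nia.
  (* The difference x + beta - (r + a) is positive, but smaller than beta. *)
  have lt_r : r + a < x + beta by nia.
  by have := coef_gap_ge Exy lt_r; lia.
- by exists (x - a), (y + (alpha - b)); nia.
- by exists (x + (beta - a)), (y - b); nia.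
Qed.

(** * The dual as the complement of a union of rectangles *)

Lemma dual_DeltaE (n : nat) (i a b : nat -> nat) :
  (forall k, 1 <= k <= n -> gap_coord alpha beta (i k) (a k) (b k)) ->
  dual (gen2 alpha beta)
    (Delta (gen2 alpha beta) ([set 0] `|`
      [set i k | k in [set k | 1 <= k <= n]]))
  = [set c | exists x y : nat, c = ((x * alpha + y * beta)%N%:Z)%R /\
       forall k, 1 <= k <= n -> a k <= x \/ b k <= y].
Proof.
move=> i_coord; have G0 : gen2 alpha beta 0 by exists 0, 0.
apply/seteqP; split=> c.
- move=> cD; have inD j :
      ([set 0] `|` [set i k | k in [set k | 1 <= k <= n]]) j ->
      exists2 g, gen2 alpha beta g & (g%:Z = c + j%:Z)%R.
    move=> Ij; apply: cD; exists (j%:Z)%R => //.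
    by exists j => //; exists 0 => //; rewrite GRing.add0r.
  have [g [x [y ->]] Ec] := inD 0 (or_introl erefl).
  have {}Ec : c = ((x * alpha + y * beta)%N%:Z)%R by lia.
  exists x, y; split=> // k kn; apply/(gen2D_gap _ _ (i_coord k kn)).
  have [|h Gh Eh] := inD (i k); first by right; exists k.
  by suff <- : h = x * alpha + y * beta + i k by []; lia.
- case=> x [y [-> xy]] _ [_ [j Ij [g [r [s ->]] <-]] <-].
  have [u [v Euv]] : gen2 alpha beta (x * alpha + y * beta + j).
    case: Ij => [->|[k kn <-]]; first by exists x, y; rewrite addn0.
    by apply/(gen2D_gap _ _ (i_coord k kn)); exact: xy.
  exists ((u + r) * alpha + (v + s) * beta); last by lia.
  by exists (u + r), (v + s).
Qed.

End Gen2.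

(** * Inner corners of a staircase *)

(** A point outside the staircase that is not to the right of the first
rectangle lies above it; it either stays above every rectangle, or there is a
first step at which it passes from above the k-th one to the right of the next
one. *)
Lemma staircaseP (n : nat) (a b : nat -> nat) (x y : nat) : 1 <= n ->
  (forall k, 1 <= k < n -> a k.+1 <= a k /\ b k <= b k.+1) ->
  (forall k, 1 <= k <= n -> a k <= x \/ b k <= y) <->
  [\/ a 1 <= x, exists2 k, 1 <= k < n & a k.+1 <= x /\ b k <= y | b n <= y].
Proof.
move=> n_gt0 ab_mono.
have mono j k : 1 <= j -> j <= k -> k <= n -> a k <= a j /\ b j <= b k.
  move=> j1; elim: k => [|k IHk] jk kn; first by lia.
  have [->|neq] := eqVneq j k.+1; first by [].
  have [||aj bj] := IHk; [by lia..|].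
  by have [|] := ab_mono k; lia.
split=> [out|corner k kn].
- have climb m : 1 <= m <= n ->
    [\/ a 1 <= x, exists2 k, 1 <= k < n & a k.+1 <= x /\ b k <= y | b m <= y].
    elim: m => [//|m IHm] mn; have [->|m0] := eqVneq m 0.
      by have [|?|?] := out 1; [lia|apply: Or31|apply: Or33].
    have [|||bm] := IHm; [by lia|by apply: Or31|by apply: Or32|].
    have [//|am|?] := out m.+1; last exact: Or33.
    by apply: Or32; exists m; first lia.
  by apply: climb; lia.
- case: corner => [a1x|[j jn [ajx bjy]]|bny].
  + by left; have [|||] := mono 1 k; lia.
  + have [kj|jk] := leqP k j.
      by right; have [|||] := mono k j; lia.
    by left; have [|||] := mono j.+1 k; lia.
  + by right; have [|||] := mono k n; lia.
Qed.

Arguments staircaseP {n a b x y}.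

Theorem theorem3p3 (alpha beta : nat) (Gamma : set nat)
    (alpha_gt0 : 0 < alpha) (lt_alpha_beta : alpha < beta)
    (co_alpha_beta : coprime alpha beta)
    (Gamma_numsg : numerical_semigroup Gamma)
    (Gamma_gen : Gamma = gen2 alpha beta)
    (n : nat) (n_gt0 : 1 <= n) (I : set nat) (i a b : nat -> nat)
    (I_lean : lean_set Gamma I)
    (I_enum : I = [set 0] `|` [set i k | k in [set k | 1 <= k <= n]])
    (i_gap : forall k, 1 <= k <= n -> gap Gamma (i k))
    (i_coord : forall k, 1 <= k <= n -> gap_coord alpha beta (i k) (a k) (b k))
    (i_incr : forall k, 1 <= k < n -> ltL alpha beta (i k) (i k.+1)) :
  dual Gamma (Delta Gamma I) =
    translate Gamma (a 1 * alpha)%N%:Z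
    `|` \bigcup_(k in [set k | 1 <= k < n])
          translate Gamma (a k.+1 * alpha + b k * beta)%N%:Z
    `|` translate Gamma (b n * beta)%N%:Z.
Proof.
have ab_mono k : 1 <= k < n -> a k.+1 <= a k /\ b k <= b k.+1.
  move=> kn; have Ck : gap_coord alpha beta (i k) (a k) (b k).
    by apply: i_coord; lia.
  have Ck1 : gap_coord alpha beta (i k.+1) (a k.+1) (b k.+1).
    by apply: i_coord; lia.
  have := gap_coord_ltL alpha_gt0 co_alpha_beta Ck Ck1 (i_incr k kn).
  by lia.
rewrite I_enum Gamma_gen (dual_DeltaE alpha_gt0 co_alpha_beta i_coord).
(* The two outer corners lie on the axes: their other coordinate is 0. *)
have -> : a 1 * alpha = a 1 * alpha + 0 * beta by rewrite addn0.
have -> : b n * beta = 0 * alpha + b n * beta by [].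
rewrite !translate_gen2E.
apply/seteqP; split=> c.
- case=> x [y [-> /(staircaseP n_gt0 ab_mono)]].
  case=> [a1x|[k kn [akx bky]]|bny].
  + by left; left; exists x, y.
  + by left; right; exists k; rewrite ?translate_gen2E //; exists x, y.
  + by right; exists x, y.
- case=> [[[x [y [a1x _ ->]]]|[k kn]]|[x [y [_ bny ->]]]].
  + exists x, y; split=> //.
    by apply: (iffRL (staircaseP n_gt0 ab_mono)); apply: Or31.
  + rewrite translate_gen2E => -[x [y [akx bky ->]]]; exists x, y; split=> //.
    by apply: (iffRL (staircaseP n_gt0 ab_mono)); apply: Or32; exists k.
  + exists x, y; split=> //.
    by apply: (iffRL (staircaseP n_gt0 ab_mono)); apply: Or33.
Qed.
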